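(* Let $G$ be a finite solvable group. Let $\chi\in\mathrm{Irr}(G)$ and $g\in G$ and suppose that $\chi(g)\neq 0$. Then the order of $g$ divides $|G|/\chi(1)$.
   Context: $\mathrm{Irr}(G)$ denotes the set of irreducible complex characters of the finite group $G$. *)

(* Defs.v *)
From mathcomp Require Export all_boot all_order all_fingroup all_algebra.
From mathcomp Require Export all_solvable all_field all_character.

Set Implicit Arguments.
Unset Strict Implicit.
Unset Printing Implicit Defensive.

(* Main.v *)
Require Import Defs.
From mathcomp Require Import ring.
Import GroupScope GRing.Theory Num.Theory.
Local Open Scope ring_scope.

(** Both sides behave well under induction of characters: if [chi] is induced
    from a character [psi] of a subgroup [T], then [|G| / chi(1)] equals
    [|T| / psi(1)], and [chi(g) != 0] forces some conjugate of [g] to lie in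
    [T] with [psi] nonzero there.  By Clifford correspondence, a [chi] lying
    over a non-invariant character of a normal subgroup is so induced from a
    proper subgroup (the inertia group), and induction on [|G|] applies.

    There remains the case where [chi] is quasi-primitive: its restriction to
    every normal subgroup is a multiple of a single invariant character.  Then
    more is true: the whole exponent of [G] divides [|G| / chi(1)].  Climb a
    chief series of [G].  Across a chief factor [K / L], elementary abelian of
    prime exponent [p] since [G] is solvable, the exponent grows at most by
    the factor [p], and the order by [t = |K : L|].  The degree of the
    character under [chi] grows by a factor [e] that is [1] or satisfies
    [e ^ 2 = t]: this is the trichotomy [invariant_chief_irr_cases], whose
    third case, a restriction with several distinct constituents, contradicts
    quasi-primitivity.  In either case [p * e] divides [t]. *)

Lemma exponent_mul_quotient {gT : finGroupType} {K L : {group gT}} :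
  L <| K -> (exponent K %| exponent (K / L) * exponent L)%N.
Proof.
case/andP=> sLK nLK; apply/exponentP=> x Kx.
rewrite expgM expg_exponent // coset_idr ?groupX ?(subsetP nLK) //.
by rewrite morphX ?(subsetP nLK) // expg_exponent ?mem_quotient.
Qed.

Definition quasiprimitive {gT : finGroupType} {G : {group gT}} (i : Iirr G) :=
  [forall N : {group gT}, (N <| G) ==>
    [forall (k | k \in irr_constt ('Res[N] 'chi_i)), G \subset 'I['chi_k]]].

Lemma quasiprimitiveP {gT : finGroupType} {G : {group gT}} {i : Iirr G} :
  reflect (forall (N : {group gT}) k,
             N <| G -> k \in irr_constt ('Res[N] 'chi_i) -> G \subset 'I['chi_k])
          (quasiprimitive i).
Proof.
apply: (iffP forallP) => [qpi N k nsNG iNk | qpi N].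
  by have /implyP/(_ nsNG)/forall_inP := qpi N; apply.
by apply/implyP=> nsNG; apply/forall_inP=> k; apply: qpi.
Qed.

(** By Clifford's theorem the constituents form a single conjugacy class, which
    is a singleton here. *)
Lemma quasiprimitive_constt_eq {gT : finGroupType} {G N : {group gT}}
    {i : Iirr G} {j k : Iirr N} :
    quasiprimitive i -> N <| G ->
    j \in irr_constt ('Res[N] 'chi_i) -> k \in irr_constt ('Res[N] 'chi_i) ->
  j = k.
Proof.
move=> /quasiprimitiveP qpi nsNG iNj; rewrite irr_consttE.
rewrite (Clifford_Res_sum_cfclass nsNG iNj) cfclass_invariant; last first.
  exact: qpi iNj.
rewrite big_seq1 cfdotZl cfdot_irr.
by case: (j =P k) => // _; rewrite mulr0 eqxx.
Qed.

(** One step along a chief series.  With [p] the exponent of [K / L], either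
    [e = 1] and Lagrange's theorem gives the divisibility, or [|K : L| = e ^ 2]
    is a nontrivial power of [p], and then [p] divides [e]. *)
Lemma quasiprimitive_chief_step {gT : finGroupType} {G K L : {group gT}}
    {i : Iirr G} {s : Iirr K} :
    solvable G -> quasiprimitive i -> chief_factor G L K ->
    s \in irr_constt ('Res[K] 'chi_i) ->
  exists e : nat, exists2 u : Iirr L, 'Res[L] 'chi_s = e%:R *: 'chi_u
     & (exponent (K / L) * e %| #|K : L|)%N.
Proof.
move=> solG qpi chiefKL iKs.
have [maxL nsKG] := andP chiefKL; have [sKG nKG] := andP nsKG.
have /andP[/andP[sLK notsKL] nLG] := maxgroupp maxL.
have nsLG : L <| G by rewrite /normal (subset_trans sLK).
have nLK : K \subset 'N(L) := subset_trans sKG nLG.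
have [_ ntKL /is_abelemP[p p_pr abelKL]] :=
  minnormal_solvable (chief_factor_minnormal chiefKL) (quotientS L sKG)
    (quotient_sol L solG).
have t_gt1 : (#|K : L| > 1)%N by rewrite indexg_gt1.
have IGs : G \subset 'I['chi_s] by apply: (quasiprimitiveP qpi) iKs.
have [|[e [u resu e2t]]|[u inj_u resu]] :=
  invariant_chief_irr_cases chiefKL (abelem_abelian abelKL) IGs.
- case/irrP=> u resu; exists 1%N, u; first by rewrite scale1r.
  by rewrite muln1 -card_quotient // exponent_dvdn.
- exists e, u => //; rewrite -e2t expnS expn1 dvdn_mul //.
  have expKLp : (exponent (K / L) %| p)%N by have /and3P[] := abelKL.
  apply: dvdn_trans expKLp _.
  have: (p %| e ^ 2)%N.
    rewrite e2t -card_quotient //.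
    by have [_ ->] := pgroup_pdiv (abelem_pgroup abelKL) ntKL.
  by rewrite Euclid_dvdX // andbT.
(* Distinct constituents of the restriction of chi_s would be distinct
   constituents of the restriction of chi_i to L. *)
pose o0 := Ordinal (ltnW t_gt1); pose o1 := Ordinal t_gt1.
have constt_u o : u o \in irr_constt ('Res[L] 'chi_i).
  rewrite -(cfResRes _ sLK sKG).
  apply: (constt_Res_trans (cfRes_char _ (irr_char i)) iKs).
  rewrite irr_consttE resu cfdot_suml (bigD1 o) //= big1 => [|o' ne_o'o].
    by rewrite addr0 cfdot_irr eqxx oner_eq0.
  by rewrite cfdot_irr (inj_eq inj_u) (negPf ne_o'o).
by have /inj_u := quasiprimitive_constt_eq qpi nsLG (constt_u o0) (constt_u o1).
Qed.

(** Stated for every normal subgroup [K] below [G], not only for [G], so as to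
    climb a chief series of [G] one factor at a time. *)
Lemma quasiprimitive_exponent_dvd {gT : finGroupType} {G K : {group gT}}
    {i : Iirr G} {s : Iirr K} :
    solvable G -> quasiprimitive i -> K <| G ->
    s \in irr_constt ('Res[K] 'chi_i) ->
  ((exponent K)%:R * 'chi_s 1%g %| #|K|%:R)%C.
Proof.
move=> solG qpi; have [m] := ubnP #|K|.
elim: m K s => // m IHm K s leKm nsKG iKs.
have [K1 | ntK] := eqVneq K 1%G.
  subst K; rewrite exponent1 mul1r cards1 lin_char1 ?dvdC_refl //.
  by apply/char_abelianP/abelian1.
have [L maxL] : {L : {group gT} | maxnormal L K G}.
  by apply: ex_maxgroup; exists 1%G; rewrite proper1G ntK norms1.
have /andP[ltLK nLG] := maxgroupp maxL; have sLK := proper_sub ltLK.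
have sKG := normal_sub nsKG.
have nsLG : L <| G by rewrite /normal (subset_trans sLK).
have nsLK : L <| K := normalS sLK sKG nsLG.
have [|e [u resu dv_e]] := @quasiprimitive_chief_step _ G K L i s solG qpi _ iKs.
  exact/andP.
have degs : 'chi_s 1%g = e%:R * 'chi_u 1%g.
  by rewrite -(cfRes1 L) resu cfunE.
have nz_e : e%:R != 0 :> algC.
  by apply: contra (irr1_neq0 s); rewrite degs => /eqP->; rewrite mul0r.
have iLu : u \in irr_constt ('Res[L] 'chi_i).
  rewrite -(cfResRes _ sLK sKG).
  apply: (constt_Res_trans (cfRes_char _ (irr_char i)) iKs).
  by rewrite irr_consttE resu cfdotZl cfdot_irr eqxx mulr1.
have dvL := IHm L u (leq_trans (proper_card ltLK) leKm) nsLG iLu.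
have [z Zz defL] := dvdCP _ _ dvL.
have /dvdnP[a def_a] := dv_e.
have /dvdnP[b def_b] := exponent_mul_quotient nsLK.
apply/dvdCP; exists (a%:R * b%:R * z); first by rewrite !rpredM ?rpred_nat.
rewrite -(Lagrange sLK) natrM defL def_a degs !natrM.
have := congr1 (fun n => n%:R : algC) def_b; rewrite !natrM => eq_b.
by ring: eq_b.
Qed.

(** Clifford correspondence: [T] is the inertia group of a non-invariant
    constituent of the restriction of ['chi_i] to some normal subgroup. *)
Lemma not_quasiprimitive_induced {gT : finGroupType} {G : {group gT}}
    {i : Iirr G} :
    ~~ quasiprimitive i ->
  exists2 T : {group gT}, T \proper G & exists s : Iirr T, 'chi_i = 'Ind[G] 'chi_s.
Proof.
case/forallPn=> N; rewrite negb_imply => /andP[nsNG].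
case/forall_inPn=> k iNk notIGk.
exists 'I_G['chi_k]%G.
  by rewrite properE subsetIl /= subsetI subxx.
have [irrInd _ imInd _ _] := constt_Inertia_bijection k nsNG.
have: i \in irr_constt ('Ind[G] 'chi_k) by rewrite constt_Ind_Res.
rewrite -imInd => /imsetP[s Ts ->]; exists s.
by rewrite cfIirrE ?irrInd.
Qed.

Lemma cfInd_neq0_conj {gT : finGroupType} {G T : {group gT}} {phi : 'CF(T)} {g} :
    T \subset G -> 'Ind[G] phi g != 0 ->
  exists2 y, y \in G & phi (g ^ y)%g != 0.
Proof.
move=> sTG; rewrite cfIndE // => nz_g; apply/exists_inP.
apply: contraNT nz_g => /exists_inPn-all0.
by rewrite big1 ?mulr0 // => y /all0; rewrite negbK => /eqP.
Qed.

(** The divisibility is stated without a quotient so that the factor [|G : T|]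
    gained by both [|G|] and the degree under induction from [T] cancels. *)
Lemma order_mul_irr1_dvd {gT : finGroupType} {G : {group gT}} {i : Iirr G} {g} :
    solvable G -> 'chi_i g != 0 ->
  (#[g]%g%:R * 'chi_i 1%g %| #|G|%:R)%C.
Proof.
have [m] := ubnP #|G|; elim: m G i g => // m IHm G i g leGm solG nz_g.
have [qpi | /not_quasiprimitive_induced[T ltTG [s def_i]]] :=
  boolP (quasiprimitive i).
  have Gg : g \in G by apply: contraR nz_g => /cfun0->.
  have iGi : i \in irr_constt ('Res[G] 'chi_i).
    by rewrite cfRes_id irr_consttE cfdot_irr eqxx oner_eq0.
  have [z Zz ->] :=
    dvdCP _ _ (quasiprimitive_exponent_dvd solG qpi (normal_refl G) iGi).
  have /dvdnP[a ->] := dvdn_exponent Gg.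
  apply/dvdCP; exists (z * a%:R); first by rewrite rpredM ?rpred_nat.
  by rewrite natrM !mulrA.
have sTG := proper_sub ltTG; rewrite def_i in nz_g *.
have [y Gy nz_y] := cfInd_neq0_conj sTG nz_g.
rewrite cfInd1 // mulrCA -(Lagrange sTG) mulnC natrM dvdC_mul2l ?neq0CiG //.
rewrite -(orderJ g y).
exact: IHm (leq_trans (proper_card ltTG) leGm) (solvableS sTG solG) nz_y.
Qed.

Theorem corollary4p3 (gT : finGroupType) (G : {group gT}) (chi : 'CF(G)) (g : gT) :
  solvable G -> chi \in irr G -> g \in G -> chi g != 0 ->
  (#[g]%g%:R %| #|G|%:R / chi 1%g)%C.
Proof.
move=> solG /irrP[i ->] _ nz_g.
rewrite -(dvdC_mul2r _ _ (irr1_neq0 i)) divfK ?irr1_neq0 //.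
exact: order_mul_irr1_dvd.
Qed.
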